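(* Let $n\ge2$ and $r\ge3$ be integers and let $q=e^{\pi i/r}$, $s=q^{r-1}$ and $t=s^{-3}(1-q^2)$. Let $\boldsymbol W_{n,2}\subset\widetilde{\boldsymbol N}_{n,2,0}(q,s,t)$ be the $B_n$-submodule spanned by the vectors $w_{i,j}$, $1\le i<j\le n$. The short exact sequence of $B_n$-modules $$0\longrightarrow\boldsymbol W_{n,2}\hookrightarrow\widetilde{\boldsymbol N}_{n,2,0}(q,s,t)\longrightarrow\widetilde{\boldsymbol N}_{n,2,0}(q,s,t)/\boldsymbol W_{n,2}\longrightarrow0$$ does not split if and only if $n\equiv-1\pmod r$.
   Context: $B_n$ is the braid group with Artin generators $\sigma_1,\dots,\sigma_{n-1}$. For $q,s,t\in\mathbb C^\times$, $\widetilde{\boldsymbol N}_{n,2,0}(q,s,t)$ is the complex vector space with basis $b$ and $w_{i,j}$ ($1\le i<j\le n$), with $B_n$-action $\sigma_i w_{j,k}=w_{j,k}$ if $\{i,i+1\}\cap\{j,k\}=\emptyset$; $\sigma_i w_{i+1,j}=s^{-1}w_{i,j}$ ($j>i+1$); $\sigma_i w_{j,i+1}=s^{-1}w_{j,i}$ ($j<i$); $\sigma_i w_{i,j}=s^{-1}w_{i+1,j}+(1-s^{-2})w_{i,j}-s^{i-j-1}(1-s^{-2})q^2w_{i,i+1}$ ($j>i+1$); $\sigma_i w_{i,i+1}=s^{-4}q^2w_{i,i+1}$; $\sigma_i w_{j,i}=s^{-1}w_{j,i+1}+(1-s^{-2})w_{j,i}-s^{i-j-1}(1-s^{-2})w_{i,i+1}$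 ($j<i$); $\sigma_i b=b+t\,w_{i,i+1}$. The span of the $w_{i,j}$ is the Lawrence–Krammer–Bigelow representation specialized at these values. *)

(* Defs.v *)
From HB Require Import structures.
From mathcomp Require Import all_boot all_order all_algebra.
From mathcomp Require Import ring zify.
From mathcomp Require Import boolp reals sequences exp trigo.
From mathcomp Require Import complex.

Set Implicit Arguments.
Unset Strict Implicit.
Unset Printing Implicit Defensive.
Import Order.TTheory GRing.Theory Num.Theory.
Local Open Scope ring_scope.

(* A letter [(i, true)] stands for the Artin generator number [i + 1], and
   [(i, false)] for its inverse: generators, like the strands, are numbered
   from 0 here.  All formulas below only involve differences of indices. *)
Definition braid_word (n : nat) := seq ('I_n.-1 * bool).

Inductive braid_eq (n : nat) : braid_word n -> braid_word n -> Prop :=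
| BraidRefl u : braid_eq u u
| BraidSym u v : braid_eq u v -> braid_eq v u
| BraidTrans u v w : braid_eq u v -> braid_eq v w -> braid_eq u w
| BraidCat u u' v v' :
    braid_eq u u' -> braid_eq v v' -> braid_eq (u ++ v) (u' ++ v')
| BraidInv i b : braid_eq [:: (i, b); (i, ~~ b)] [::]
| BraidFar (i j : 'I_n.-1) : (i.+1 < j)%N ->
    braid_eq [:: (i, true); (j, true)] [:: (j, true); (i, true)]
| BraidNear (i j : 'I_n.-1) : j = i.+1 :> nat ->
    braid_eq [:: (i, true); (j, true); (i, true)]
             [:: (j, true); (i, true); (j, true)].

Section BraidGroup.
Variable n : nat.

Definition braid_eqb : rel (braid_word n) := fun u v => `[< braid_eq u v >].

Lemma braid_eqb_equiv : equiv_class_of braid_eqb.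
Proof.
split=> [u|u v|v u w].
- exact/asboolP/BraidRefl.
- by apply/asboolP/asboolP; apply: BraidSym.
- by move=> /asboolP uv /asboolP vw; apply/asboolP/(BraidTrans uv vw).
Qed.

Canonical braid_eqb_equivRel := EquivRelPack braid_eqb_equiv.
Canonical braid_eqb_encModRel := defaultEncModRel braid_eqb.

Local Open Scope quotient_scope.

Definition braid := {eq_quot braid_eqb}.
HB.instance Definition _ := Choice.on braid.
HB.instance Definition _ := EqQuotient.on braid.

Definition braid_of (u : braid_word n) : braid := \pi_braid u.

Lemma braid_ofP u v : braid_of u = braid_of v <-> braid_eq u v.
Proof.
split=> [e|e]; last by apply/eqmodP/asboolP.
by move/eqmodP: e => /asboolP.
Qed.

Lemma braid_reprK (g : braid) : braid_of (repr g) = g.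
Proof. exact: reprK. Qed.

Lemma braid_eq_repr u : braid_eq (repr (braid_of u)) u.
Proof. by apply/braid_ofP; rewrite braid_reprK. Qed.

Definition inv_word (u : braid_word n) : braid_word n :=
  rev [seq (l.1, ~~ l.2) | l <- u].

Lemma inv_wordM u v : inv_word (u ++ v) = inv_word v ++ inv_word u.
Proof. by rewrite /inv_word map_cat rev_cat. Qed.

Lemma inv_wordK : involutive inv_word.
Proof.
move=> u; rewrite /inv_word map_rev revK -map_comp -[RHS]map_id.
by apply: eq_map => -[i b] /=; rewrite negbK.
Qed.

Lemma inv_word_left u : braid_eq (inv_word u ++ u) [::].
Proof.
elim: u => [|[i b] u IHu]; first exact: BraidRefl.
rewrite -cat1s inv_wordM -catA (catA _ [:: (i, b)]).
apply: (BraidTrans _ IHu); apply: BraidCat; first exact: BraidRefl.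
rewrite -[X in braid_eq _ X]cat0s; apply: BraidCat; last exact: BraidRefl.
by have /= := BraidInv i (~~ b); rewrite negbK.
Qed.

Lemma inv_word_right u : braid_eq (u ++ inv_word u) [::].
Proof. by have := inv_word_left (inv_word u); rewrite inv_wordK. Qed.

Definition braid_mul (g h : braid) : braid := braid_of (repr g ++ repr h).
Definition braid_one : braid := braid_of [::].
Definition braid_inv (g : braid) : braid := braid_of (inv_word (repr g)).

Lemma braid_mulE u v : braid_mul (braid_of u) (braid_of v) = braid_of (u ++ v).
Proof. by apply/braid_ofP/BraidCat; apply: braid_eq_repr. Qed.

Lemma braid_mulA : associative braid_mul.
Proof.
move=> g h k; rewrite -[g]braid_reprK -[h]braid_reprK -[k]braid_reprK.
by rewrite !braid_mulE catA.
Qed.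

Lemma braid_mul1 : left_id braid_one braid_mul.
Proof. by move=> g; rewrite -[g]braid_reprK braid_mulE. Qed.

Lemma braid_mulr1 : right_id braid_one braid_mul.
Proof. by move=> g; rewrite -[g]braid_reprK braid_mulE cats0. Qed.

Lemma braid_mulV : left_inverse braid_one braid_inv braid_mul.
Proof.
move=> g; rewrite -{2}[g]braid_reprK braid_mulE.
exact/braid_ofP/inv_word_left.
Qed.

Lemma braid_mulrV : right_inverse braid_one braid_inv braid_mul.
Proof.
move=> g; rewrite -{1}[g]braid_reprK braid_mulE.
exact/braid_ofP/inv_word_right.
Qed.

HB.instance Definition _ := isGroup.Build braid
  braid_mulA braid_mul1 braid_mulr1 braid_mulV braid_mulrV.

Definition artin (i : 'I_n.-1) : braid := braid_of [:: (i, true)].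

End BraidGroup.

Section GModules.
Variables (G : groupType) (K : fieldType).

(* The structure of a [G]-module over [K] on the vector space [V]. *)
Record gmod (V : lmodType K) := GMod {
  gact : G -> V -> V;
  gact_linear : forall g, linear (gact g);
  gact1 : forall v, gact 1%g v = v;
  gactM : forall g h v, gact (g * h)%g v = gact g (gact h v) }.

Record ghom (V W : lmodType K) (a : gmod V) (b : gmod W) := GHom {
  ghom_fun :> V -> W;
  ghom_linear : linear ghom_fun;
  ghom_equivariant : forall g v, ghom_fun (gact a g v) = gact b g (ghom_fun v) }.

Record short_exact (A B C : lmodType K) (a : gmod A) (b : gmod B) (c : gmod C)
    := ShortExact {
  ses_inj : ghom a b;
  ses_proj : ghom b c;
  ses_injective : injective ses_inj;
  ses_surjective : forall z, exists y, ses_proj y = z;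
  ses_exact : forall y, ses_proj y = 0 <-> exists x, ses_inj x = y }.

Definition splits (A B C : lmodType K) (a : gmod A) (b : gmod B) (c : gmod C)
    (E : short_exact a b c) : Prop :=
  exists h : ghom c b, forall z, ses_proj E (h z) = z.

Definition gstable (V : vectType K) (a : gmod V) (U : {vspace V}) : Prop :=
  forall g v, v \in U -> gact a g v \in U.

End GModules.

(* [Quotient.quot] only carries an additive group structure. *)
Section QuotientSpace.
Variables (K : fieldType) (V : vectType K) (U : {vspace V}).
Local Open Scope quotient_scope.

Definition vquot := {ideal_quot (pred_of_vspace U)}.
HB.instance Definition _ := GRing.Zmodule.on vquot.
Definition vproj (v : V) : vquot := \pi_{ideal_quot (pred_of_vspace U)} v.

Lemma vprojP v w : vproj v = vproj w <-> v - w \in U.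
Proof.
rewrite /vproj Quotient.idealrBE; split => [->|/eqP //]; exact: eqxx.
Qed.

Lemma vprojK (x : vquot) : vproj (repr x) = x.
Proof. exact: reprK. Qed.

Lemma vprojB : {morph vproj : v w / v - w}.
Proof. exact: pi_is_zmod_morphism. Qed.
Lemma vprojD : {morph vproj : v w / v + w}.
Proof. by move=> v w; rewrite /vproj /= !piE. Qed.

Definition vquot_scale (c : K) (x : vquot) : vquot := vproj (c *: repr x).

Lemma vquot_scaleE c v : vquot_scale c (vproj v) = vproj (c *: v).
Proof.
apply/vprojP; rewrite -scalerBr; apply: rpredZ.
by apply/vprojP; rewrite vprojK.
Qed.

Lemma vquot_scaleA a b x :
  vquot_scale a (vquot_scale b x) = vquot_scale (a * b) x.
Proof. by rewrite -[x]vprojK !vquot_scaleE scalerA. Qed.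
Lemma vquot_scale1 : left_id 1 vquot_scale.
Proof. by move=> x; rewrite -[x]vprojK vquot_scaleE scale1r. Qed.
Lemma vquot_scaleDr : right_distributive vquot_scale +%R.
Proof.
move=> c x y; rewrite -[x]vprojK -[y]vprojK -vprojD !vquot_scaleE.
by rewrite scalerDr vprojD.
Qed.
Lemma vquot_scaleDl x : {morph vquot_scale^~ x : a b / a + b}.
Proof.
by move=> a b; rewrite -[x]vprojK !vquot_scaleE scalerDl vprojD.
Qed.

HB.instance Definition _ := GRing.Zmodule_isLmodule.Build K vquot
  vquot_scaleA vquot_scale1 vquot_scaleDr vquot_scaleDl.

Lemma vproj_linear : linear vproj.
Proof. by move=> c v w; rewrite vprojD -vquot_scaleE. Qed.

End QuotientSpace.

Section SubQuotientModules.
Variables (G : groupType) (K : fieldType) (V : vectType K).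
Variables (a : gmod G V) (U : {vspace V}) (aU : gstable a U).

Definition gsub_act (g : G) (x : subvs_of U) : subvs_of U :=
  Sub (gact a g (vsval x)) (aU g (subvsP x)).

Lemma gsub_act_linear g : linear (gsub_act g).
Proof. by move=> c x y; apply: val_inj; rewrite /= gact_linear. Qed.
Lemma gsub_act1 x : gsub_act 1%g x = x.
Proof. by apply: val_inj; rewrite /= gact1. Qed.
Lemma gsub_actM g h x : gsub_act (g * h)%g x = gsub_act g (gsub_act h x).
Proof. by apply: val_inj; rewrite /= gactM. Qed.

Definition gsub : gmod G (subvs_of U) :=
  GMod gsub_act_linear gsub_act1 gsub_actM.

Definition gquot_act (g : G) (x : vquot U) : vquot U :=
  vproj U (gact a g (repr x)).

Lemma gact0 g : gact a g 0 = 0.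
Proof.
have := gact_linear a g 1 0 0; rewrite !scale1r addr0 => e.
by apply: (addrI (gact a g 0)); rewrite -e addr0.
Qed.

Lemma gactD g : {morph gact a g : v w / v + w}.
Proof. by move=> v w; have := gact_linear a g 1 v w; rewrite !scale1r. Qed.

Lemma gactZ g c : {morph gact a g : v / c *: v}.
Proof. by move=> v; have := gact_linear a g c v 0; rewrite gact0 !addr0. Qed.

Lemma gactB g : {morph gact a g : v w / v - w}.
Proof. by move=> v w; rewrite gactD -scaleN1r gactZ scaleN1r. Qed.

Lemma gquot_actE g v : gquot_act g (vproj U v) = vproj U (gact a g v).
Proof. by apply/vprojP; rewrite -gactB; apply/aU/vprojP; rewrite vprojK. Qed.

Lemma gquot_act_linear g : linear (gquot_act g).
Proof.
move=> c x y; rewrite -[x]vprojK -[y]vprojK -vproj_linear !gquot_actE.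
by rewrite gact_linear vproj_linear.
Qed.
Lemma gquot_act1 x : gquot_act 1%g x = x.
Proof. by rewrite -[x]vprojK gquot_actE gact1. Qed.
Lemma gquot_actM g h x : gquot_act (g * h)%g x = gquot_act g (gquot_act h x).
Proof. by rewrite -[x]vprojK !gquot_actE gactM. Qed.

Definition gquot : gmod G (vquot U) :=
  GMod gquot_act_linear gquot_act1 gquot_actM.

Definition gsub_incl : ghom gsub a :=
  @GHom _ _ _ _ gsub a (fun x => vsval x) (fun c x y => erefl) (fun g x => erefl).

Definition gquot_proj : ghom a gquot :=
  @GHom _ _ _ _ a gquot _ (@vproj_linear _ _ U) (fun g v => esym (gquot_actE g v)).

Lemma gsub_incl_inj : injective gsub_incl.
Proof. exact: val_inj. Qed.
Lemma gquot_proj_surj z : exists y, gquot_proj y = z.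
Proof. by exists (repr z); exact: vprojK. Qed.
Lemma gsub_quot_exact y :
  gquot_proj y = 0 <-> exists x, gsub_incl x = y.
Proof.
have -> : 0 = vproj U 0.
  by rewrite -[in RHS](subrr (0 : V)) vprojB subrr.
apply: (iff_trans (vprojP _ _ _)); rewrite subr0; split=> [Uy|[x <-]].
  by exists (Sub y Uy).
exact: subvsP.
Qed.

Definition sub_quot_ses : short_exact gsub a gquot :=
  ShortExact gsub_incl_inj gquot_proj_surj gsub_quot_exact.

End SubQuotientModules.

(* Automorphisms of [V] subject to the braid relations define a module over the
   braid group. *)
Section BraidModule.
Variables (K : fieldType) (V : vectType K) (n : nat) (f : 'I_n.-1 -> 'End(V)).
Hypothesis f_aut : forall i, lker (f i) == 0%VS.
Hypothesis f_far : forall i j : 'I_n.-1, (i.+1 < j)%N ->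
  (f i \o f j = f j \o f i)%VF.
Hypothesis f_near : forall i j : 'I_n.-1, j = i.+1 :> nat ->
  (f i \o (f j \o f i) = f j \o (f i \o f j))%VF.

Definition letter_act (l : 'I_n.-1 * bool) : 'End(V) :=
  if l.2 then f l.1 else (f l.1)^-1%VF.

Fixpoint word_act (u : braid_word n) (v : V) : V :=
  if u is l :: u' then letter_act l (word_act u' v) else v.

Lemma word_act_cat u u' v : word_act (u ++ u') v = word_act u (word_act u' v).
Proof. by elim: u => //= l u ->. Qed.

Lemma word_act_eq u u' : braid_eq u u' -> word_act u =1 word_act u'.
Proof.
elim=> {u u'} [u|u u' _ IH|u u' u'' _ IH1 _ IH2|u u' w w' _ IH1 _ IH2
             |i b|i j ij|i j ij] v //.
- by rewrite IH1 IH2.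
- by rewrite !word_act_cat IH2 IH1.
- case: b => /=; rewrite /letter_act /=; last by rewrite lker0_lfunK.
  by rewrite lker0_lfunVK.
- by have /lfunP/(_ v) := f_far ij; rewrite !lfunE.
- by have /lfunP/(_ v) := f_near ij; rewrite !lfunE /= !lfunE.
Qed.

Definition braid_act (g : braid n) (v : V) : V := word_act (repr g) v.

Lemma braid_actE u : braid_act (braid_of u) =1 word_act u.
Proof. exact/word_act_eq/braid_eq_repr. Qed.

Lemma braid_act_linear g : linear (braid_act g).
Proof.
by move=> c v w; rewrite /braid_act; elim: (repr g) => //= l u ->; rewrite linearP.
Qed.
Lemma braid_act1 v : braid_act 1%g v = v.
Proof. exact: braid_actE. Qed.
Lemma braid_actM g h v : braid_act (g * h)%g v = braid_act g (braid_act h v).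
Proof. by rewrite braid_actE word_act_cat. Qed.

Definition braid_gmod : gmod (braid n) V :=
  GMod braid_act_linear braid_act1 braid_actM.

Lemma braid_gmod_artin i v : gact braid_gmod (artin i) v = f i v.
Proof. exact: braid_actE. Qed.

Lemma braid_gstable (U : {vspace V}) :
  (forall i, (f i @: U <= U)%VS) -> gstable braid_gmod U.
Proof.
move=> fU g v Uv; rewrite /= /braid_act; elim: (repr g) => //= -[i b] u IH.
rewrite /letter_act; case: b => /=.
  by apply: (subvP (fU i)); apply: memv_img.
have /eqP fUE : (f i @: U == U)%VS.
  rewrite eqEdim fU /= limg_dim_eq //.
  by rewrite (eqP (f_aut i)) capv0.
have [w Uw ->] : exists2 w, w \in U & word_act u v = f i w.
  by apply/memv_imgP; rewrite fUE.
by rewrite lker0_lfunK.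
Qed.

End BraidModule.

(* Underlying space of the module [Ntilde] below: coordinate [None] is along
   the vector b, and coordinate [Some (j, k)] along the vector w_{j,k}. *)
Definition strand_pair (n : nat) := {p : 'I_n * 'I_n | (p.1 < p.2)%N}.
Definition Nspace (K : fieldType) (n : nat) := {ffun option (strand_pair n) -> K^o}.

Section LKB.
Variables (K : fieldType) (n : nat).
Local Notation V := (Nspace K n).

Definition bvec : V := [ffun x => (x == None)%:R].

(* [wvec j k] is a basis vector when [j < k < n], and 0 otherwise. *)
Definition wvec (j k : nat) : V :=
  [ffun x : option (strand_pair n) =>
     (if x is Some p then ((val p).1 == j :> nat) && ((val p).2 == k :> nat)
      else false)%:R].

Variables (q s t : K).

Definition sigma_w (i j k : nat) : V :=
  if (j == i) && (k == i.+1) then (s ^- 4 * q ^+ 2) *: wvec i i.+1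
  else if j == i.+1 then s^-1 *: wvec i k
  else if k == i.+1 then s^-1 *: wvec j i
  else if j == i then
    s^-1 *: wvec i.+1 k + (1 - s ^- 2) *: wvec i k
      - (s ^ (i%:Z - k%:Z - 1) * (1 - s ^- 2) * q ^+ 2) *: wvec i i.+1
  else if k == i then
    s^-1 *: wvec j i.+1 + (1 - s ^- 2) *: wvec j i
      - (s ^ (i%:Z - j%:Z - 1) * (1 - s ^- 2)) *: wvec i i.+1
  else wvec j k.

Definition sigma_b (i : nat) : V := bvec + t *: wvec i i.+1.

Definition sigma_fun (i : nat) (v : V) : V :=
  v None *: sigma_b i
  + \sum_(p : strand_pair n) v (Some p) *: sigma_w i (val p).1 (val p).2.

Lemma sigma_fun_linear i : linear (sigma_fun i).
Proof.
move=> c u v; rewrite /sigma_fun [in RHS]scalerDr scaler_sumr addrACA -big_split /=.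
congr (_ + _); first by rewrite !ffunE scalerA -scalerDl.
by apply: eq_bigr => p _; rewrite !ffunE scalerA -scalerDl.
Qed.
HB.instance Definition _ i :=
  GRing.isLinear.Build K V V *:%R (sigma_fun i) (sigma_fun_linear i).

Definition sigma (i : nat) : 'End(V) := linfun (sigma_fun i).

Lemma sigma_bE i : sigma i bvec = sigma_b i.
Proof.
rewrite lfunE /= /sigma_fun ffunE eqxx scale1r big1 ?addr0 // => p _.
by rewrite ffunE scale0r.
Qed.

Lemma sigma_wE i j k : (j < k < n)%N -> sigma i (wvec j k) = sigma_w i j k.
Proof.
move=> /andP[jk kn]; have jn := ltn_trans jk kn.
pose p0 : strand_pair n := exist (fun p : 'I_n * 'I_n => p.1 < p.2)%N
  (Ordinal jn, Ordinal kn) jk.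
rewrite lfunE /= /sigma_fun ffunE scale0r add0r.
rewrite (bigD1 p0) //= ffunE /= !eqxx scale1r big1 ?addr0 //.
move=> p pN; rewrite ffunE; case: andP => [[/eqP e1 /eqP e2]|_]; last first.
  by rewrite scale0r.
case/eqP: pN; apply: val_inj; case: p e1 e2 => -[x y] xy /= e1 e2.
by congr (_, _); apply: val_inj.
Qed.

Lemma Nspace_dec (v : V) :
  v = v None *: bvec + \sum_(p : strand_pair n) v (Some p) *: wvec (val p).1 (val p).2.
Proof.
apply/ffunP => -[p|]; rewrite !ffunE sum_ffunE; last first.
  rewrite eqxx big1 => [|p _]; last by rewrite !ffunE; exact: mulr0.
  by rewrite addr0; exact/esym/mulr1.
rewrite (bigD1 p) //= !ffunE !eqxx big1 => [|p' p'N].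
  by rewrite addr0 -[RHS]/(v None * 0 + v (Some p) * 1 : K) mulr0 add0r mulr1.
rewrite !ffunE; case: andP => [[/eqP e1 /eqP e2]|_]; last exact: mulr0.
case/eqP: p'N; apply: val_inj; case: p p' e1 e2 => -[x y] xy [[x' y'] xy'] /= e1 e2.
by congr (_, _); apply: val_inj.
Qed.

Lemma Nspace_ext (f g : 'End(V)) : f bvec = g bvec ->
  (forall j k, (j < k < n)%N -> f (wvec j k) = g (wvec j k)) -> f = g.
Proof.
move=> fgb fgw; apply/lfunP => v; rewrite (Nspace_dec v) !linearD !linearZ /=.
rewrite fgb !linear_sum; congr (_ + _); apply: eq_bigr => p _.
by rewrite !linearZ /= fgw // (valP p) /=.
Qed.

End LKB.

(* The braid relations on the spanning vectors [w j k] and [b].  They only use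
   the action formulas, hence the abstract vectors and linear forms [ev]. *)
Section LKBRelations.
Variables (K : fieldType) (n : nat) (q s t : K).
Hypothesis s0 : s != 0.
Variables (V : lmodType K) (I : Type) (ev : I -> V -> K).
Hypothesis evD : forall x u v, ev x (u + v) = ev x u + ev x v.
Hypothesis evN : forall x u, ev x (- u) = - ev x u.
Hypothesis evZ : forall x c u, ev x (c *: u) = c * ev x u.
Hypothesis ev_inj : forall u v, (forall x, ev x u = ev x v) -> u = v.
Variables (w : nat -> nat -> V) (b : V) (sg : nat -> V -> V).
Hypothesis sgD : forall i u v, sg i (u + v) = sg i u + sg i v.
Hypothesis sgN : forall i u, sg i (- u) = - sg i u.
Hypothesis sgZ : forall i c u, sg i (c *: u) = c *: sg i u.
Hypothesis sgE : forall i j k, (j < k < n)%N -> sg i (w j k) =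
 if (j == i) && (k == i.+1) then (s ^- 4 * q ^+ 2) *: w i i.+1
  else if j == i.+1 then s^-1 *: w i k
  else if k == i.+1 then s^-1 *: w j i
  else if j == i then
    s^-1 *: w i.+1 k + (1 - s ^- 2) *: w i k
      - (s ^ (i%:Z - k%:Z - 1) * (1 - s ^- 2) * q ^+ 2) *: w i i.+1
  else if k == i then
    s^-1 *: w j i.+1 + (1 - s ^- 2) *: w j i
      - (s ^ (i%:Z - j%:Z - 1) * (1 - s ^- 2)) *: w i i.+1
  else w j k.
Hypothesis sb : forall i, sg i b = b + t *: w i i.+1.

Ltac sigma_case := move=> *; rewrite sgE;
  [repeat (case: eqP => /= ?; try lia) => // | lia].

Let sw_disj i j k : (j < k < n)%N -> j != i -> j != i.+1 -> k != i ->
  k != i.+1 -> sg i (w j k) = w j k.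
Proof. by sigma_case. Qed.
Let sw_arc i : (i.+1 < n)%N -> sg i (w i i.+1) = (s ^- 4 * q ^+ 2) *: w i i.+1.
Proof. by sigma_case. Qed.
Let sw_Sl i k : (i.+1 < k < n)%N -> sg i (w i.+1 k) = s^-1 *: w i k.
Proof. by sigma_case. Qed.
Let sw_Sr i j : (j < i)%N -> (i.+1 < n)%N -> sg i (w j i.+1) = s^-1 *: w j i.
Proof. by sigma_case. Qed.
Let sw_l i k : (i.+1 < k < n)%N -> sg i (w i k) =
  s^-1 *: w i.+1 k + (1 - s ^- 2) *: w i k
      - (s ^ (i%:Z - k%:Z - 1) * (1 - s ^- 2) * q ^+ 2) *: w i i.+1.
Proof. by sigma_case. Qed.
Let sw_r i j : (j < i)%N -> (i.+1 < n)%N -> sg i (w j i) =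
  s^-1 *: w j i.+1 + (1 - s ^- 2) *: w j i
      - (s ^ (i%:Z - j%:Z - 1) * (1 - s ^- 2)) *: w i i.+1.
Proof. by sigma_case. Qed.

Let exp_diag (i : nat) : s ^ (i%:Z - i%:Z - 1) = s^-1.
Proof. by rewrite subrr sub0r exprN1. Qed.
Let exp_Sr (i k : nat) : s ^ (i%:Z - k.+1%:Z - 1) = s ^ (i%:Z - k%:Z - 1) * s^-1.
Proof. by rewrite -[s^-1]exprN1 -expfzDr //; congr (s ^ _); lia. Qed.
Let exp_Sl (i k : nat) : s ^ (i.+1%:Z - k%:Z - 1) = s ^ (i%:Z - k%:Z - 1) * s.
Proof. by rewrite -{3}[s]expr1z -expfzDr //; congr (s ^ _); lia. Qed.


Ltac sigma_step := match goal with
  | |- context [sg ?i (w ?j ?k)] =>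
    first [ rewrite (@sw_disj i j k); [|lia..]
          | rewrite (@sw_arc i); [|lia]
          | rewrite (@sw_Sl i k); [|lia]
          | rewrite (@sw_Sr i j); [|lia..]
          | rewrite (@sw_l i k); [|lia]
          | rewrite (@sw_r i j); [|lia..] ]
  | |- context [sg ?i b] => rewrite (sb i)
  end.

Ltac vec_field := apply: ev_inj => x;
  repeat match goal with |- context [w ?j ?k] =>
    generalize (w j k); intro end;
  rewrite ?(evD, evN, evZ) ?(exp_Sr, exp_Sl) ?exp_diag;
  repeat match goal with |- context [s ^ ?e] => generalize (s ^ e); intro end;
  try (by field; rewrite ?s0).

Ltac sigma_solve := repeat (sigma_step; rewrite ?(sgD, sgN, sgZ));
  vec_field.

Lemma sigma_near_b i : (i.+2 < n)%N ->
  sg i (sg i.+1 (sg i b)) = sg i.+1 (sg i (sg i.+1 b)).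
Proof. by move=> i2n; sigma_solve. Qed.

Lemma sigma_far_b i h : (i.+1 < h)%N -> (h.+1 < n)%N ->
  sg i (sg h b) = sg h (sg i b).
Proof. by move=> ih hn; sigma_solve. Qed.

Lemma sigma_near_w i j k : (i.+2 < n)%N -> (j < k < n)%N ->
  sg i (sg i.+1 (sg i (w j k))) = sg i.+1 (sg i (sg i.+1 (w j k))).
Proof.
move=> i2n jkn.
case: (eqVneq j i) => [?|?]; last case: (eqVneq j i.+1) => [?|?];
  last case: (eqVneq j i.+2) => [?|?].
all: case: (eqVneq k i) => [?|?]; last case: (eqVneq k i.+1) => [?|?];
  last case: (eqVneq k i.+2) => [?|?].
all: try lia; subst; sigma_solve.
Qed.

Lemma sigma_far_w i h j k : (i.+1 < h)%N -> (h.+1 < n)%N -> (j < k < n)%N ->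
  sg i (sg h (w j k)) = sg h (sg i (w j k)).
Proof.
move=> ih hn jkn.
case: (eqVneq j i) => [?|?]; last case: (eqVneq j i.+1) => [?|?];
  last case: (eqVneq j h) => [?|?]; last case: (eqVneq j h.+1) => [?|?].
all: case: (eqVneq k i) => [?|?]; last case: (eqVneq k i.+1) => [?|?];
  last case: (eqVneq k h) => [?|?]; last case: (eqVneq k h.+1) => [?|?].
all: try lia; subst; sigma_solve.
Qed.

End LKBRelations.

Section LKBAutomorphisms.
Variables (K : fieldType) (n : nat) (q s t : K).
Hypotheses (q0 : q != 0) (s0 : s != 0).
Local Notation V := (Nspace K n).
Local Notation w := (@wvec K n).
Local Notation b := (@bvec K n).
Variable sg : nat -> 'End(V).
Hypothesis sgw : forall i j k, (j < k < n)%N -> sg i (w j k) = sigma_w n q s i j k.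
Hypothesis sgb : forall i, sg i b = sigma_b n t i.

Let ev (x : option (strand_pair n)) (v : V) : K := v x.
Let evD x u v : ev x (u + v) = ev x u + ev x v. Proof. exact: ffunE. Qed.
Let evN x u : ev x (- u) = - ev x u. Proof. exact: ffunE. Qed.
Let evZ x c u : ev x (c *: u) = c * ev x u. Proof. exact: ffunE. Qed.
Let ev_inj u v : (forall x, ev x u = ev x v) -> u = v.
Proof. by move=> e; apply/ffunP. Qed.
Let sgD i u v : sg i (u + v) = sg i u + sg i v. Proof. exact: linearD. Qed.
Let sgN i u : sg i (- u) = - sg i u. Proof. exact: linearN. Qed.
Let sgZ i c u : sg i (c *: u) = c *: sg i u. Proof. exact: linearZ. Qed.

Lemma sigma_near_aux i : (i.+2 < n)%N ->
  (sg i \o (sg i.+1 \o sg i) = sg i.+1 \o (sg i \o sg i.+1))%VF.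
Proof.
move=> i2n; apply: Nspace_ext => [|j k jkn]; rewrite !comp_lfunE.
  exact: (sigma_near_b s0 evD evN evZ ev_inj sgD sgN sgZ sgw sgb).
exact: (sigma_near_w s0 evD evN evZ ev_inj sgD sgN sgZ sgw).
Qed.

Lemma sigma_far_aux i h : (i.+1 < h)%N -> (h.+1 < n)%N ->
  (sg i \o sg h = sg h \o sg i)%VF.
Proof.
move=> ih hn; apply: Nspace_ext => [|j k jkn]; rewrite !comp_lfunE.
  exact: (sigma_far_b s0 evD evZ ev_inj sgD sgZ sgw sgb).
exact: (sigma_far_w s0 evD evN evZ ev_inj sgD sgN sgZ sgw).
Qed.

Lemma sigma_aut_aux i : (i.+1 < n)%N -> lker (sg i) == 0%VS.
Proof.
move=> i1n.
have img v : sg i v \in limg (sg i) by rewrite memv_img ?memvf.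
have imgZ c v : c != 0 -> (c *: v \in limg (sg i)) = (v \in limg (sg i)).
  by move=> c0; rewrite rpredZeq (negPf c0).
have s10 : s^-1 != 0 by rewrite invr_eq0.
have warc : w i i.+1 \in limg (sg i).
  rewrite -(imgZ (s ^- 4 * q ^+ 2)); last by rewrite mulf_neq0 ?expf_neq0 ?invr_eq0 ?expf_neq0.
  by have := img (w i i.+1); rewrite sgw /sigma_w ?eqxx //; lia.
have wl k : (i.+1 < k < n)%N -> w i k \in limg (sg i).
  move=> kn; rewrite -(imgZ s^-1) //.
  have := img (w i.+1 k); rewrite sgw ?kn //=.
  by rewrite /sigma_w; repeat (case: eqP => //= ?; try lia).
have wr j : (j < i)%N -> w j i \in limg (sg i).
  move=> ji; rewrite -(imgZ s^-1) //.
  have := img (w j i.+1); rewrite sgw; last lia.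
  by rewrite /sigma_w; repeat (case: eqP => //= ?; try lia).
have wSl k : (i.+1 < k < n)%N -> w i.+1 k \in limg (sg i).
  move=> kn; rewrite -(imgZ s^-1) //.
  have := img (w i k); rewrite sgw; last lia.
  rewrite /sigma_w; repeat (case: eqP => //= ?; try lia).
  rewrite rpredBr; last by apply: rpredZ.
  by rewrite rpredDr //; apply/rpredZ/wl.
have wSr j : (j < i)%N -> w j i.+1 \in limg (sg i).
  move=> ji; rewrite -(imgZ s^-1) //.
  have := img (w j i); rewrite sgw; last lia.
  rewrite /sigma_w; repeat (case: eqP => //= ?; try lia).
  rewrite rpredBr; last by apply: rpredZ.
  by rewrite rpredDr //; apply/rpredZ/wr.
have wall j k : (j < k < n)%N -> w j k \in limg (sg i).
  move=> jkn.
  case: (eqVneq j i) => [?|?]; last case: (eqVneq j i.+1) => [?|?].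
  - by subst; case: (eqVneq k i.+1) => [->//|?]; apply: wl; lia.
  - by subst; apply: wSl; lia.
  case: (eqVneq k i) => [?|?]; last case: (eqVneq k i.+1) => [?|?].
  - by subst; apply: wr; lia.
  - by subst; apply: wSr; lia.
  have := img (w j k); rewrite sgw //.
  by rewrite /sigma_w; repeat (case: eqP => //= ?; try lia).
have ball : b \in limg (sg i).
  by have := img b; rewrite sgb /sigma_b rpredDr // rpredZ.
have lf : limg (sg i) = fullv.
  apply/eqP; rewrite eqEsubv subvf; apply/subvP => v _; rewrite (Nspace_dec v).
  rewrite rpredD ?rpredZ // rpred_sum // => p _.
  by rewrite rpredZ // wall // (valP p) /=.
have := limg_ker_dim (sg i) fullv; rewrite lf capfv => /eqP.
by rewrite -[X in _ == X]add0n eqn_add2r dimv_eq0.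
Qed.

End LKBAutomorphisms.

Section LKBModule.
Variables (K : fieldType) (n : nat) (q s t : K).
Hypotheses (q0 : q != 0) (s0 : s != 0).

Definition sigma_gen (i : 'I_n.-1) : 'End(Nspace K n) := sigma n q s t i.

Lemma ord_pred_lt (i : 'I_n.-1) : (i.+1 < n)%N.
Proof. by have := ltn_ord i; lia. Qed.

Lemma sigma_aut i : lker (sigma_gen i) == 0%VS.
Proof.
exact: (sigma_aut_aux q0 s0 (@sigma_wE K n q s t) (@sigma_bE K n q s t)
  (ord_pred_lt i)).
Qed.

Lemma sigma_far (i j : 'I_n.-1) : (i.+1 < j)%N ->
  (sigma_gen i \o sigma_gen j = sigma_gen j \o sigma_gen i)%VF.
Proof.
move=> ij; exact: (sigma_far_aux s0 (@sigma_wE K n q s t)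
  (@sigma_bE K n q s t) ij (ord_pred_lt j)).
Qed.

Lemma sigma_near (i j : 'I_n.-1) : j = i.+1 :> nat ->
  (sigma_gen i \o (sigma_gen j \o sigma_gen i)
   = sigma_gen j \o (sigma_gen i \o sigma_gen j))%VF.
Proof.
move=> ij; have := ord_pred_lt j; rewrite /sigma_gen ij => i2n.
exact: (sigma_near_aux s0 (@sigma_wE K n q s t) (@sigma_bE K n q s t) i2n).
Qed.

Definition Ntilde : gmod (braid n) (Nspace K n) :=
  braid_gmod sigma_aut sigma_far sigma_near.

Definition Wspace : {vspace Nspace K n} :=
  <<[seq wvec K n (val p).1 (val p).2 | p : strand_pair n]>>%VS.

Lemma mem_Wspace j k : wvec K n j k \in Wspace.
Proof.
have [/andP[jk kn]|/negP jkn] := boolP (j < k < n)%N; last first.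
  suff -> : wvec K n j k = 0 by apply: mem0v.
  apply/ffunP => -[p|]; rewrite !ffunE //.
  case: andP => // -[/eqP pj /eqP pk]; case: jkn.
  by rewrite -pj -pk (valP p) /=.
have jn := ltn_trans jk kn.
pose p0 : strand_pair n := exist (fun p : 'I_n * 'I_n => p.1 < p.2)%N
  (Ordinal jn, Ordinal kn) jk.
by apply/memv_span/mapP; exists p0; rewrite ?mem_enum.
Qed.

Lemma Wspace_stable : gstable Ntilde Wspace.
Proof.
apply: braid_gstable => i; rewrite limg_span.
apply/span_subvP => _ /mapP[_ /mapP[p _ ->] ->].
rewrite sigma_wE ?(valP p) ?ltn_ord // /sigma_w.
repeat case: ifP => _; by rewrite ?(rpredB, rpredD, rpredZ, mem_Wspace).
Qed.

Definition Wses : short_exact (gsub Wspace_stable) Ntilde (gquot Wspace_stable) :=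
  sub_quot_ses Wspace_stable.

End LKBModule.

Section RootOfUnity.
Variable R : realType.
Local Open Scope complex_scope.

Definition cexp (z : R[i]) : R[i] :=
  (expR (complex.Re z))%:C * (cos (complex.Im z) +i* sin (complex.Im z)).

Definition q_ (r : nat) : R[i] := cexp ((pi : R)%:C * 'i / r%:R).
Definition s_ (r : nat) : R[i] := q_ r ^+ r.-1.
Definition t_ (r : nat) : R[i] := s_ r ^- 3 * (1 - q_ r ^+ 2).

Lemma cexp_neq0 z : cexp z != 0.
Proof.
rewrite mulf_neq0 //; first by rewrite eq_complex /= eqxx andbT gt_eqF ?expR_gt0.
rewrite eq_complex /=; apply/negP => /andP[/eqP cz /eqP sz].
by have /eqP := cos2Dsin2 (complex.Im z);
  rewrite cz sz !expr0n addr0 eq_sym oner_eq0.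
Qed.

Lemma q_neq0 r : q_ r != 0.
Proof. exact: cexp_neq0. Qed.

Lemma s_neq0 r : s_ r != 0.
Proof. by rewrite expf_neq0 ?q_neq0. Qed.

End RootOfUnity.

(* Main.v *)
(* Since the braid group acts trivially on the quotient, a splitting is a vector
   [b + x], with [x] in the span of the [w j k], fixed by all generators.  Here
   [q^2 = s^-2]; put [a = s^-1].  Comparing coordinates away from [w i i.+1]
   forces the coefficient of [w j k] in [x] to be [c * a^(j+k)], for a
   constant [c].  In the remaining coordinate [w i i.+1] the sums telescope, and the
   condition becomes [c * (a^(2n+3) - a) = - t] for every [i].  As [t] is nonzero,
   it can be solved if and only if [a^(2n+2) = q^(2(n+1))] is not [1], that is,
   if and only if [r] does not divide [n + 1]. *)
From HB Require Import structures.
Require Import Defs.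
From mathcomp Require Import all_boot all_order all_algebra.
From mathcomp Require Import ring lra zify.
From mathcomp Require Import reals exp trigo complex.
Import Order.TTheory GRing.Theory Num.Theory.
Local Open Scope ring_scope.

(** Nested sums over naturals make it possible to isolate single rows and columns and to
    telescope. *)
Lemma sum_strand_pair (U : nmodType) (n : nat) (F : nat -> nat -> U) :
  \sum_(p : strand_pair n) F (val p).1 (val p).2
  = \sum_(0 <= k < n) \sum_(0 <= j < k) F j k.
Proof.
rewrite -(big_sub (fun p : 'I_n * 'I_n => p.1 < p.2)%N
  (fun p : 'I_n * 'I_n => F p.1 p.2)).
rewrite big_mkord.
under [RHS]eq_bigr => k _ do
  rewrite (big_nat_widen _ _ _ _ _ (ltnW (ltn_ord k))) big_mkord.
by rewrite (exchange_big_dep xpredT) //= pair_big_dep.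
Qed.

(** * Coordinates along [bvec] and the [wvec j k] *)

Section NspaceCoordinates.
Variables (K : fieldType) (n : nat).
Local Notation V := (Nspace K n).
Local Notation w := (wvec K n).

Lemma NspaceD (u v : V) x : (u + v) x = u x + v x :> K.
Proof. exact: ffunE. Qed.
Lemma NspaceN (u : V) x : (- u) x = - u x :> K.
Proof. exact: ffunE. Qed.
Lemma NspaceZ c (u : V) x : (c *: u) x = c * u x :> K.
Proof. exact: ffunE. Qed.

Definition coord0 (v : V) : K := v None.
Fact coord0_linear : linear (coord0 : V -> K^o).
Proof. by move=> c u v; rewrite /coord0 NspaceD NspaceZ. Qed.
HB.instance Definition _ :=
  GRing.isLinear.Build K V K^o *:%R (coord0 : V -> K^o) coord0_linear.

Lemma coord0D u v : coord0 (u + v) = coord0 u + coord0 v.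
Proof. exact: linearD. Qed.
Lemma coord0Z c u : coord0 (c *: u) = c * coord0 u.
Proof. exact: linearZ. Qed.
Lemma coord0_b : coord0 (bvec K n) = 1.
Proof. by rewrite /coord0 ffunE eqxx. Qed.
Lemma coord0_w j k : coord0 (w j k) = 0.
Proof. by rewrite /coord0 ffunE. Qed.

(** Presenting the submodule as the kernel of a linear form turns questions about classes in the
    quotient into equations in [K]. *)
Lemma mem_WspaceE v : (v \in Wspace K n) = (coord0 v == 0).
Proof.
apply/idP/eqP => [Wv|v0].
  have /subvP/(_ v Wv) : (Wspace K n <= lker (linfun (coord0 : V -> K^o)))%VS.
    by apply/span_subvP => _ /mapP[p _ ->]; rewrite memv_ker lfunE /= coord0_w.
  by rewrite memv_ker lfunE => /eqP.
rewrite (Nspace_dec v) [v None]v0 scale0r add0r.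
by apply: rpred_sum => p _; rewrite rpredZ ?mem_Wspace.
Qed.

(* Unlike a coordinate function, it makes sense for all natural numbers
   [j] and [k]: it vanishes unless [j < k < n]. *)
Definition wcoord (j k : nat) (v : V) : K :=
  \sum_(p : strand_pair n | ((val p).1 == j :> nat) && ((val p).2 == k :> nat))
    v (Some p).

Fact wcoord_linear j k : linear (wcoord j k : V -> K^o).
Proof.
move=> c u v; rewrite /wcoord scaler_sumr -big_split /=.
by apply: eq_bigr => p _; rewrite NspaceD NspaceZ.
Qed.
HB.instance Definition _ j k :=
  GRing.isLinear.Build K V K^o *:%R (wcoord j k : V -> K^o) (wcoord_linear j k).

Lemma wcoord_pair v (p : strand_pair n) : wcoord (val p).1 (val p).2 v = v (Some p).
Proof.
rewrite /wcoord (bigD1 p) /= ?eqxx // big1 ?addr0 //.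
move=> p' /andP[/andP[/eqP e1 /eqP e2] /eqP[]].
apply: val_inj; case: p p' e1 e2 => -[x y] xy [[x' y'] xy'] /= e1 e2.
by congr (_, _); apply: val_inj.
Qed.

Lemma wcoord_w j k j' k' : (j' < k' < n)%N ->
  wcoord j k (w j' k') = ((j == j') && (k == k'))%:R.
Proof.
move=> /andP[jk kn]; have jn := ltn_trans jk kn.
pose p0 : strand_pair n := exist (fun p : 'I_n * 'I_n => p.1 < p.2)%N
  (Ordinal jn, Ordinal kn) jk.
have [/andP[/eqP-> /eqP->]|ne] := boolP (_ && _).
  by rewrite (wcoord_pair _ p0) ffunE !eqxx.
rewrite /wcoord big1 // => p /andP[/eqP e1 /eqP e2].
by rewrite ffunE e1 e2 (negPf ne).
Qed.

Lemma Nspace_wcoord (v : V) :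
  v = coord0 v *: bvec K n
      + \sum_(0 <= k < n) \sum_(0 <= j < k) wcoord j k v *: w j k.
Proof.
rewrite -(sum_strand_pair _ _ (fun j k => wcoord j k v *: w j k)).
rewrite [LHS]Nspace_dec; congr (_ + _).
by apply: eq_bigr => p _; rewrite wcoord_pair.
Qed.

End NspaceCoordinates.

(** * Vectors fixed by all generators when [q^2 = s^-2] *)

Section FixedVectors.
Variables (K : fieldType) (n : nat) (q s t : K).
Hypotheses (s0 : s != 0) (qs : q ^+ 2 = s ^- 2).
Local Notation V := (Nspace K n).
Local Notation w := (wvec K n).
Local Notation b := (bvec K n).
Local Notation sg := (sigma n q s t).
Local Notation c0 := (coord0 K n).
Local Notation wc := (wcoord K n).
Local Notation sgw := (sigma_w n q s).

(** Natural exponents let the integer power in the action formula combine with the weights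
    [s^-1 ^+ (j + k)]. *)
Lemma exp_arc (i k : nat) :
  s ^ (i%:Z - k%:Z - 1) = s^-1 ^+ k.+1 * s ^+ i.
Proof.
rewrite exprVn exprnN exprnP -expfzDr //.
by congr (s ^ _); lia.
Qed.

(** For [j < k < n], this is the contribution of [w j k] to [sg i u - u], where [u] is the sum of
    the [s^-1 ^+ (j + k) *: w j k]. *)
Definition wdiff (i j k : nat) : V := s^-1 ^+ (j + k) *: (sgw i j k - w j k).

Lemma wdiff_disjoint i j k : j != i -> j != i.+1 -> k != i -> k != i.+1 ->
  wdiff i j k = 0.
Proof.
rewrite /wdiff /sigma_w => /negPf-> /negPf-> /negPf-> /negPf-> /=.
by rewrite subrr scaler0.
Qed.

Ltac wdiff_field := apply/ffunP => x;
  rewrite !(NspaceD, NspaceN, NspaceZ) ?exp_arc ?qs ?mul2n -?addnn ?addnS ?addSn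
    ?exprS ?exprD ?exprVn ?expr0;
  field; rewrite ?oner_eq0 ?s0 ?expf_neq0 //.

Lemma wdiff_arc i :
  wdiff i i i.+1 = (s^-1 ^+ (2 * i + 7) - s^-1 ^+ (2 * i + 1)) *: w i i.+1.
Proof. by rewrite /wdiff /sigma_w !eqxx /=; wdiff_field. Qed.

(** The weights are chosen so that the components along [w i k] and [w i.+1 k] cancel. What survives
    is written as a difference of consecutive terms, ready to telescope over [k]. *)
Lemma wdiff_left i k : (i.+1 < k)%N -> wdiff i i k + wdiff i i.+1 k =
  (s^-1 ^+ (2 * k.+1 + 3) - s^-1 ^+ (2 * k + 3)) *: w i i.+1.
Proof.
move=> ik; rewrite /wdiff /sigma_w.
repeat (case: eqP => //= ?; try lia).
wdiff_field.
Qed.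

Lemma wdiff_right i j : (j < i)%N -> wdiff i j i + wdiff i j i.+1 =
  (s^-1 ^+ (2 * j.+1 + 1) - s^-1 ^+ (2 * j + 1)) *: w i i.+1.
Proof.
move=> ik; rewrite /wdiff /sigma_w.
repeat (case: eqP => //= ?; try lia).
wdiff_field.
Qed.

(** With [a = s^-1], the pairs ending at [i] or [i.+1] telescope to [a^(2i+1) - a], the arc gives
    [a^(2i+7) - a^(2i+1)], and the pairs starting there give [a^(2n+3) - a^(2i+7)]. The dependence
    on [i] disappears. *)
Lemma wdiff_sum i : (i.+1 < n)%N ->
  \sum_(0 <= k < n) \sum_(0 <= j < k) wdiff i j k
  = (s^-1 ^+ (2 * n + 3) - s^-1) *: w i i.+1.
Proof.
move=> i1n.
rewrite (@big_cat_nat _ _ _ i) //=; last lia.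
rewrite big1_seq ?add0r; last first.
  move=> k; rewrite mem_index_iota => ki; rewrite big1_seq // => j.
  by rewrite mem_index_iota => jk; apply: wdiff_disjoint; lia.
rewrite (@big_ltn _ _ _ i); last lia.
rewrite (@big_ltn _ _ _ i.+1); last lia.
(* The last term of column [i.+1] is the arc; the rest pairs off with column [i]. *)
rewrite [X in _ + (X + _)]big_nat_recr //= !addrA -big_split /=.
rewrite (eq_big_nat _ _ (fun j ji => wdiff_right i j (proj2 (andP ji)))).
rewrite -scaler_suml (telescope_sumr (fun j => s^-1 ^+ (2 * j + 1))) //.
rewrite wdiff_arc.
rewrite (@eq_big_nat _ _ _ i.+2 n _ (fun k =>
  (s^-1 ^+ (2 * k.+1 + 3) - s^-1 ^+ (2 * k + 3)) *: w i i.+1)); last first.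
  move=> k ik; rewrite (@big_cat_nat _ _ _ i) //=; last lia.
  rewrite big1_seq ?add0r; last first.
    by move=> j; rewrite mem_index_iota => jk; apply: wdiff_disjoint; lia.
  rewrite (@big_ltn _ _ _ i); last lia.
  rewrite (@big_ltn _ _ _ i.+1); last lia.
  rewrite big1_seq ?addr0; last first.
    by move=> j; rewrite mem_index_iota => jk; apply: wdiff_disjoint; lia.
  by rewrite wdiff_left //; lia.
rewrite -scaler_suml (telescope_sumr (fun k => s^-1 ^+ (2 * k + 3))) //.
rewrite -!scalerDl muln0 add0n expr1; congr (_ *: _).
have -> : (2 * i.+2 + 3 = 2 * i + 7)%N by lia.
by ring.
Qed.

Lemma wcoordD j k u v : wc j k (u + v) = wc j k u + wc j k v.
Proof. exact: linearD. Qed.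
Lemma wcoordN j k u : wc j k (- u) = - wc j k u.
Proof. exact: linearN. Qed.
Lemma wcoordZ j k c u : wc j k (c *: u) = c * wc j k u.
Proof. exact: linearZ. Qed.

Lemma wcoord_b j k : wc j k b = 0.
Proof. by rewrite /wcoord big1 // => p _; rewrite ffunE. Qed.

Lemma wcoord_sigma i j k v : wc j k (sg i v) =
  c0 v * (t * wc j k (w i i.+1))
  + \sum_(0 <= k' < n) \sum_(0 <= j' < k')
      wc j' k' v * wc j k (sgw i j' k').
Proof.
rewrite [in LHS](Nspace_wcoord _ _ v) linearD linearZ /= sigma_bE.
rewrite wcoordD wcoordZ /sigma_b wcoordD wcoordZ wcoord_b add0r.
congr (_ + _).
rewrite !linear_sum; apply: eq_big_nat => k' kn.
rewrite !linear_sum; apply: eq_big_nat => j' jk.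
by rewrite !linearZ /= sigma_wE //; lia.
Qed.

Ltac wcoord_cases := rewrite /sigma_w; repeat (case: eqP => //= ?; try lia);
  rewrite ?(wcoordD, wcoordN, wcoordZ) ?wcoord_w; try lia;
  repeat (case: eqP => //= ?; try lia); subst.

(** Only [w 0 k.+1] is sent to a vector with a component along [w 0 k.+2], which yields a recursion
    along the row [j = 0] for a fixed vector. *)
Lemma wcoord_row k i j : (k.+2 < n)%N -> (j < i < n)%N ->
  wc 0 k.+2 (sgw k.+1 j i) = s^-1 * ((j == 0) && (i == k.+1))%:R.
Proof. by move=> kn jin; wcoord_cases; ring. Qed.

Lemma wcoord_arc i j : (j < i < n)%N ->
  wc 0 1 (sgw 0 j i) =
  (j == 0)%:R * if i == 1 then s^-1 ^+ 6 else s^-1 ^+ (i + 5) - s^-1 ^+ (i + 3).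
Proof.
move=> jin; wcoord_cases; rewrite ?exp_arc ?qs ?addnS ?addn0 ?exprVn ?exprS.
all: by field; rewrite ?oner_eq0 ?s0 ?expf_neq0.
Qed.

Lemma sum_row (F : nat -> nat -> K) :
  (forall i j, (0 < j < i)%N -> (i < n)%N -> F j i = 0) ->
  \sum_(0 <= i < n) \sum_(0 <= j < i) F j i = \sum_(1 <= i < n) F 0 i.
Proof.
move=> F0; have [->|n0] := posnP n; first by rewrite !big_geq.
rewrite big_ltn // [X in X + _]big_geq // add0r; apply: eq_big_nat => i /andP[i0 i_n].
rewrite big_ltn // big1_seq ?addr0 // => j.
by rewrite mem_index_iota => /= /F0 ->.
Qed.

Lemma fixed_row v k : (forall i, (i.+1 < n)%N -> sg i v = v) ->
  (k.+1 < n)%N -> wc 0 k.+1 v = s^-1 ^+ k * wc 0 1 v.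
Proof.
move=> fv; elim: k => [|k IHk] kn; first by rewrite mul1r.
rewrite -{1}(fv k.+1) // wcoord_sigma wcoord_w; last lia.
rewrite /= !mulr0 add0r sum_row; last first.
  by move=> i [//|j] ji i_n; rewrite wcoord_row //= ?mulr0 //; lia.
rewrite (bigD1_seq k.+1) ?mem_index_iota ?iota_uniq //=; last lia.
rewrite wcoord_row ?eqxx; [|lia..].
rewrite big1_seq => [|i /andP[/negPf ik]]; last first.
  by rewrite mem_index_iota => i_n; rewrite wcoord_row ?ik ?mulr0 //; lia.
by rewrite IHk ?exprS /=; [ring|lia].
Qed.

(** For necessity, the row [j = 0] suffices: by [fixed_row] it is geometric, and the coordinate of
    [sg 0 v = v] along [w 0 1] involves no other row. *)
Lemma fixed_obstruction v : (1 < n)%N ->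
  (forall i, (i.+1 < n)%N -> sg i v = v) ->
  c0 v * t = (1 - s^-1 ^+ (2 * n + 2)) * wc 0 1 v.
Proof.
move=> n1 fv.
have : wc 0 1 (sg 0 v) = wc 0 1 v by rewrite fv.
rewrite wcoord_sigma wcoord_w // mulr1 sum_row; last first.
  by move=> i [//|j] ji i_n; rewrite wcoord_arc ?mul0r ?mulr0 //; lia.
rewrite big_ltn // wcoord_arc // eqxx mul1r.
(* The factor [s^-1 ^+ i.-1] from [fixed_row] turns the exponents [i + 5] and [i + 3] into
   [2 * i.+1 + 2] and [2 * i + 2]. *)
rewrite (@eq_big_nat _ _ _ 2 n _ (fun i =>
  (s^-1 ^+ (2 * i.+1 + 2) - s^-1 ^+ (2 * i + 2)) * wc 0 1 v)); last first.
  move=> [//|i] /andP[i1 i_n]; rewrite (fixed_row v i fv i_n) wcoord_arc ?i_n //.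
  rewrite mul1r gtn_eqF //.
  have -> : (2 * i.+2 + 2 = i + (i.+1 + 5))%N by lia.
  have -> : (2 * i.+1 + 2 = i + (i.+1 + 3))%N by lia.
  by rewrite !(exprD _ i); ring.
rewrite -mulr_suml (telescope_sumr (fun i => s^-1 ^+ (2 * i + 2))) //.
by move/(canRL (addrK _)) => ->; ring.
Qed.

Lemma fixed_exists : s^-1 ^+ (2 * n + 2) != 1 ->
  exists v, c0 v = 1 /\ forall i, (i.+1 < n)%N -> sg i v = v.
Proof.
move=> ne1.
(* By [wdiff_sum], this scalar makes the defect of [c *: u] cancel the term [t *: w i i.+1] of
   [sigma_b], for all [i] at once. *)
pose c := - t / (s^-1 ^+ (2 * n + 3) - s^-1).
pose u := \sum_(0 <= k < n) \sum_(0 <= j < k) s^-1 ^+ (j + k) *: w j k.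
have c00 : c0 u = 0.
  rewrite linear_sum big1 // => k _; rewrite linear_sum big1 // => j _.
  by rewrite /= coord0Z coord0_w mulr0.
exists (b + c *: u); split=> [|i i_n].
  by rewrite coord0D coord0Z c00 coord0_b mulr0 addr0.
rewrite linearD linearZ /= sigma_bE.
have -> : sg i u = u + (s^-1 ^+ (2 * n + 3) - s^-1) *: w i i.+1.
  rewrite -wdiff_sum // linear_sum -big_split; apply: eq_big_nat => k kn /=.
  rewrite linear_sum -big_split; apply: eq_big_nat => j jk /=.
  rewrite linearZ /= sigma_wE; last lia.
  by rewrite /wdiff -scalerDr addrC subrK.
rewrite scalerDr scalerA /c divfK; last first.
  rewrite addnS exprS -[X in _ - X]mulr1 -mulrBr mulf_neq0 ?invr_eq0 //.
  by rewrite subr_eq0.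
by rewrite scaleNr /sigma_b [c *: u + _]addrC addrA addrK.
Qed.

Lemma fixed_iff : (1 < n)%N -> t != 0 ->
  (exists v, c0 v = 1 /\ forall i, (i.+1 < n)%N -> sg i v = v)
  <-> s^-1 ^+ (2 * n + 2) != 1.
Proof.
move=> n1 t0; split=> [[v [v1 fv]]|]; last exact: fixed_exists.
apply: contra_neq t0 => e.
by have := fixed_obstruction _ n1 fv; rewrite v1 e subrr mul1r mul0r.
Qed.

End FixedVectors.

(** * Splittings and invariant vectors *)

Lemma braid_gmod_inv (K : fieldType) (V : vectType K) (n : nat)
    (f : 'I_n.-1 -> 'End(V)) f_aut f_far f_near (T : Type) (phi : V -> T) :
  (forall i v, phi (f i v) = phi v) ->
  forall g v, phi (gact (@braid_gmod K V n f f_aut f_far f_near) g v) = phi v.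
Proof.
move=> phif g v; rewrite /= /braid_act; elim: (repr g) => //= -[i []] u <-.
  exact: phif.
rewrite /letter_act /=; move: (word_act f u v) => {}v.
(* For an inverse letter, write [v] as an image: an injective endomorphism in finite dimension is
   onto. *)
have /memv_imgP[v' _ ->] : v \in limg (f i).
  suff -> : limg (f i) = fullv by rewrite memvf.
  apply/eqP; rewrite eqEdim subvf /= limg_dim_eq //.
  by rewrite (eqP (f_aut i)) capv0.
by rewrite lker0_lfunK // phif.
Qed.

Lemma braid_gmod_fixed (K : fieldType) (V : vectType K) (n : nat)
    (f : 'I_n.-1 -> 'End(V)) f_aut f_far f_near v :
  (forall i, f i v = v) ->
  forall g, gact (@braid_gmod K V n f f_aut f_far f_near) g v = v.
Proof.
move=> fv g; rewrite /= /braid_act; elim: (repr g) => //= -[i []] u ->.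
  exact: fv.
by rewrite /letter_act /= -{1}(fv i) lker0_lfunK.
Qed.

(** The form [phi] identifies the quotient with the trivial module of dimension one, so an
    equivariant section amounts to the image of the class of [b]. *)
Lemma sub_quot_splits (G : groupType) (K : fieldType) (V : vectType K)
    (a : gmod G V) (U : {vspace V}) (aU : gstable a U)
    (phi : {linear V -> K^o}) (b : V) :
  (forall v, (v \in U) = (phi v == 0)) ->
  (forall g v, phi (gact a g v) = phi v) -> phi b = 1 ->
  splits (sub_quot_ses aU)
  <-> exists v, phi v = 1 /\ forall g, gact a g v = v.
Proof.
move=> memU phiG b1; split=> [[h hK]|[x [x1 fx]]].
  exists (h (vproj U b)); split=> [|g].
    have /vprojP := hK (vproj U b).
    by rewrite memU linearB b1 subr_eq0 => /eqP.
  rewrite -ghom_equivariant /= (gquot_actE aU); congr (h _); apply/vprojP.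
  by rewrite memU linearB phiG subrr.
(* [phi] is constant on classes, so the choice of representative in [f] is harmless. *)
have phi_repr v : phi (repr (vproj U v)) = phi v.
  apply/eqP; rewrite -subr_eq0 -linearB -memU.
  by apply/vprojP; rewrite vprojK.
pose f (z : vquot U) : V := (phi (repr z) : K) *: x.
have f_linear : linear f.
  move=> c y z; rewrite -[y]vprojK -[z]vprojK -vproj_linear /f !phi_repr.
  by rewrite linearP scalerDl scalerA.
have f_equi g z : f (gact (gquot aU) g z) = gact a g (f z).
  rewrite -[z]vprojK /= (gquot_actE aU) /f !phi_repr phiG.
  by rewrite gactZ fx.
exists (GHom f_linear f_equi) => z; rewrite -[z]vprojK /= /f phi_repr.
by apply/vprojP; rewrite memU linearB linearZ /= x1 [_ *: 1]mulr1 subrr.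
Qed.

Section Splitting.
Variables (K : fieldType) (n : nat) (q s t : K).
Hypotheses (q0 : q != 0) (s0 : s != 0).
Local Notation V := (Nspace K n).
Local Notation c0 := (coord0 K n).
Local Notation N := (Ntilde n t q0 s0).

(** A generator moves [b] by an element of [Wspace] and maps each [w j k] into [Wspace]. *)
Lemma coord0_sigma i v : c0 (sigma n q s t i v) = c0 v.
Proof.
rewrite [in LHS](Nspace_wcoord _ _ v) linearD linearZ /= sigma_bE.
rewrite coord0D coord0Z /sigma_b coord0D coord0Z coord0_b coord0_w.
rewrite mulr0 addr0 mulr1 !linear_sum big1_seq ?addr0 // => k.
rewrite mem_index_iota => kn; rewrite !linear_sum big1_seq // => j.
rewrite mem_index_iota => jk; rewrite !linearZ /= sigma_wE; last lia.
suff /eqP-> : c0 (sigma_w n q s i j k) == 0 by apply: mulr0.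
rewrite -mem_WspaceE /sigma_w.
by repeat case: ifP => _; rewrite ?(rpredB, rpredD, rpredZ, mem_Wspace).
Qed.

Lemma Wses_splits : splits (Wses n t q0 s0) <->
  exists v, c0 v = 1 /\ forall i, (i.+1 < n)%N -> sigma n q s t i v = v.
Proof.
have c0N g v : c0 (gact N g v) = c0 v.
  by apply: braid_gmod_inv => i u; apply: coord0_sigma.
apply: (iff_trans (sub_quot_splits _ _ _ _ _ _ c0 (bvec K n)
  (mem_WspaceE K n) c0N (coord0_b K n))).
split=> -[v [v1 fv]]; exists v; split=> //; last first.
  by apply: braid_gmod_fixed => i; apply/fv/(ord_pred_lt q0 s0).
move=> i i_n; have i_lt : (i < n.-1)%N by lia.
by rewrite -[RHS](fv (artin (Ordinal i_lt))) braid_gmod_artin.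
Qed.

End Splitting.

(** * Powers of the root of unity [q] *)

Section RootsOfUnity.
Variable R : realType.
Local Open Scope complex_scope.

Lemma de_moivre (x : R) m :
  (cos x +i* sin x) ^+ m = cos (m%:R * x) +i* sin (m%:R * x).
Proof.
elim: m => [|m IHm]; first by rewrite mul0r cos0 sin0.
rewrite exprS IHm -natr1 mulrDl mul1r cosD sinD.
by apply/eqP; rewrite eq_complex /=; apply/andP; split; apply/eqP; ring.
Qed.

Lemma q_expE r m :
  q_ R r ^+ m = cos (m%:R * (pi / r%:R)) +i* sin (m%:R * (pi / r%:R)).
Proof.
rewrite -de_moivre; congr (_ ^+ _); rewrite /q_ /cexp.
have -> : (pi : R)%:C * 'i / r%:R = 0 +i* (pi / r%:R).
  have -> : (r%:R : R[i])^-1 = (r%:R^-1 : R)%:C by rewrite fmorphV rmorph_nat.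
  (* [ring] would unfold [pi]. *)
  generalize (pi : R) => p; apply/eqP; rewrite eq_complex /=.
  by apply/andP; split; apply/eqP; ring.
by rewrite expR0 mul1r.
Qed.

Lemma q_expr2r r : (0 < r)%N -> q_ R r ^+ (2 * r) = 1.
Proof.
move=> r0; rewrite q_expE //.
have -> : (2 * r)%:R * (pi / r%:R) = pi *+ 2 :> R.
  by rewrite natrM; field; rewrite pnatr_eq0; lia.
by rewrite cos2pi sin2pi.
Qed.

Lemma q_expr2_neq1 r k : (0 < k < r)%N -> q_ R r ^+ (2 * k) != 1.
Proof.
move=> /andP[k0 kr]; rewrite mulnC exprM q_expE.
set x := _ * _.
have x_itv : 0 < x < pi.
  have r0 : 0 < r%:R :> R by rewrite ltr0n; lia.
  rewrite /x mulrA; apply/andP; split.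
    by rewrite divr_gt0 // mulr_gt0 ?pi_gt0 // ltr0n.
  by rewrite ltr_pdivrMr // mulrC ltr_pM2l ?pi_gt0 // ltr_nat.
have := sin_gt0_pi x_itv; have := cos2Dsin2 x.
move: (cos x) (sin x) => c d cd d0; rewrite eq_complex /=.
apply/negP => /andP[/eqP e _].
have : 0 < d ^+ 2 by rewrite exprn_gt0.
have -> : d ^+ 2 = 0; last by rewrite ltxx.
by move: e cd; rewrite !expr2; lra.
Qed.

Lemma q_expr2_eq1 r m : (0 < r)%N -> (q_ R r ^+ (2 * m) == 1) = (r %| m)%N.
Proof.
move=> r0; rewrite {1}(divn_eq m r) mulnDr exprD mulnCA mulnC exprM q_expr2r //.
rewrite expr1n mul1r /dvdn; have [->|mr] := posnP; first by rewrite muln0 eqxx.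
by apply/negbTE/q_expr2_neq1; rewrite mr ltn_mod.
Qed.

(** Since [s = q^(r-1)], the product [q^2 * s^2] is [q^(2r) = 1]. *)
Lemma q_s r : (0 < r)%N -> q_ R r ^+ 2 = s_ R r ^- 2.
Proof.
move=> r0; rewrite -[RHS]mul1r; apply: (canRL (mulfK _)).
  by rewrite expf_neq0 ?s_neq0.
by rewrite /s_ -exprM -exprD -(q_expr2r r) //; congr (_ ^+ _); lia.
Qed.

End RootsOfUnity.

Theorem theorem5p4 (R : realType) (n r : nat) (hn : (2 <= n)%N) (hr : (3 <= r)%N) :
  ~ splits (Wses n (t_ R r) (q_neq0 R r) (s_neq0 R r))
  <-> (n%:Z = -1 %[mod r%:Z])%Z.
Proof.
have r0 : (0 < r)%N by lia.
have qs := q_s R r r0; have s0 := s_neq0 R r.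
(* The factor [1 - q^2] is nonzero because [1 < r]. *)
have t0 : t_ R r != 0.
  apply: mulf_neq0; first by rewrite invr_eq0 expf_neq0.
  by rewrite subr_eq0 eq_sym -[2%N]muln1 q_expr2_neq1 //; lia.
have splitsE : splits (Wses n (t_ R r) (q_neq0 R r) (s_neq0 R r))
    <-> ~~ (r %| n.+1)%N.
  apply: (iff_trans (Wses_splits _ _ _ _ _ _ _)).
  apply: (iff_trans (fixed_iff _ n _ _ _ s0 qs hn t0)).
  have -> : (2 * n + 2 = 2 * n.+1)%N by lia.
  by rewrite exprM exprVn -qs -exprM q_expr2_eq1.
have modE : (n%:Z = -1 %[mod r%:Z])%Z <-> (r %| n.+1)%N.
  have -> : (r %| n.+1)%N = (n%:Z == -1 %[mod r%:Z])%Z.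
    by rewrite eqz_mod_dvd opprK -[n%:Z + 1]/((n + 1)%N%:Z) addn1.
  by split=> /eqP.
split=> [nsplit|/modE dvd /splitsE]; last by rewrite dvd.
by apply/modE; apply: contraT => /splitsE.
Qed.
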